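(* Rowmotion is the only bijective cover-closure map on a finite ground set. That is: let $E$ be a finite set and $\tau:2^E\to 2^E$ a closure operator with set of closed sets $\mathcal{L}$, and suppose that cover-closure $\xi:\mathcal{L}\to\mathcal{L}$, $\xi(X)=\tau(\mathrm{cov}(X))$, is bijective. Then there is a poset $P$ such that $\mathcal{L}$ is isomorphic to $J(P)$ and, under this identification of $\mathcal{L}$ with $J(P)$, $\xi$ is rowmotion on $J(P)$.
   Context: A closure operator on $E$ is a function $\tau:2^E\to 2^E$ such that for all $X,Y\subseteq E$: $X\subseteq\tau(X)$; $X\subseteq Y$ implies $\tau(X)\subseteq\tau(Y)$; and $\tau(\tau(X))=\tau(X)$. A set $X\subseteq E$ is closed if $\tau(X)=X$. For $X\in 2^E$, $\mathrm{cov}(X)=\{e\in E\setminus X\mid X\cup\{e\}\in\mathcal{L}\}$. Cover-closure is the map $\xi:\mathcal{L}\to\mathcal{L}$ given by $\xi(X)=\tau(\mathrm{cov}(X))$. An order ideal of a poset $P$ is a subset $I\subseteq P$ such that $y\in I$ and $x\le y$ imply $x\in I$; $J(P)\subseteq 2^P$ is the set of order ideals of $P$. The rowmotion of $I\in J(P)$ is the order ideal generated by the minimal elements of $P\setminus I$. An essentialization of $(\mathcal{L},E)$, for $\mathcal{L}\subseteq 2^E$, is a pair $(\mathcal{L}',E')$ obtained as follows. Every $e\in E'$ must be an element of $E$ such that there exist $X,Y\in\mathcal{L}$ with $e\in X$ and $e\notin Y$. Also, if $Z\subseteq E$, $|Z|>1$, is such that whenever $e\in Z$ and $e\in W\in\mathcal{L}$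 we have $Z\subseteq W$, then for any maximal such $Z$ all elements of $Z$ except one are excluded from $E'$. All other elements of $E$ are kept in $E'$. Finally $\mathcal{L}'=\{X\cap E'\mid X\in\mathcal{L}\}$. Families $\mathcal{L}_1\subseteq 2^{E_1}$ and $\mathcal{L}_2\subseteq 2^{E_2}$ are isomorphic if there exists a bijection $\varphi:E_1'\to E_2'$ such that $\varphi(\mathcal{L}_1')=\mathcal{L}_2'$; the resulting identification sends $X\in\mathcal{L}_1$ to the element $Y\in\mathcal{L}_2$ with $\varphi(X\cap E_1')=Y\cap E_2'$. *)

(* Defs.v *)
From HB Require Import structures.
From mathcomp Require Import all_boot all_order.

Set Implicit Arguments.
Unset Strict Implicit.
Unset Printing Implicit Defensive.

Record closure_operator (E : finType) := ClosureOperator {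
  clo :> {set E} -> {set E};
  clo_ext : forall X : {set E}, X \subset clo X;
  clo_mono : forall X Y : {set E}, X \subset Y -> clo X \subset clo Y;
  clo_idem : forall X : {set E}, clo (clo X) = clo X
}.

Definition closed_sets (E : finType) (tau : closure_operator E)
  : {set {set E}} := [set X | tau X == X].

Lemma clo_closed (E : finType) (tau : closure_operator E) (X : {set E}) :
  tau X \in closed_sets tau.
Proof. by rewrite inE clo_idem eqxx. Qed.

Definition cov (E : finType) (L : {set {set E}}) (X : {set E}) : {set E} :=
  [set e | (e \notin X) && (X :|: [set e] \in L)].

Definition cover_closure (E : finType) (tau : closure_operator E)
    (X : {X : {set E} | X \in closed_sets tau})
  : {X : {set E} | X \in closed_sets tau} :=
  exist _ (tau (cov (closed_sets tau) (val X))) (clo_closed tau _).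

Definition order_ideals (d : Order.disp_t) (P : finPOrderType d)
  : {set {set P}} :=
  [set I : {set P} | [forall y in I, forall x, (x <= y)%O ==> (x \in I)]].

Definition minimal_elements (d : Order.disp_t) (P : finPOrderType d)
    (A : {set P}) : {set P} :=
  [set x in A | [forall y in A, ~~ (y < x)%O]].

Definition generated_ideal (d : Order.disp_t) (P : finPOrderType d)
    (A : {set P}) : {set P} :=
  [set x | [exists y in A, (x <= y)%O]].

Lemma generated_ideal_ideal (d : Order.disp_t) (P : finPOrderType d)
  (A : {set P}) : generated_ideal A \in order_ideals P.
Proof.
rewrite inE; apply/forall_inP => y; rewrite inE => /exists_inP[z zA yz].
apply/forallP => x; apply/implyP => xy; rewrite inE; apply/exists_inP.
by exists z => //; apply: Order.POrderTheory.le_trans yz.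
Qed.

Definition rowmotion (d : Order.disp_t) (P : finPOrderType d)
    (I : {I : {set P} | I \in order_ideals P})
  : {I : {set P} | I \in order_ideals P} :=
  exist _ (generated_ideal (minimal_elements (~: val I)))
          (generated_ideal_ideal _).

Definition separated (E : finType) (L : {set {set E}}) (e : E) : bool :=
  [exists X in L, e \in X] && [exists Y in L, e \notin Y].

Definition inseparable (E : finType) (L : {set {set E}}) (Z : {set E}) : bool :=
  (1 < #|Z|) && [forall e in Z, forall W in L, (e \in W) ==> (Z \subset W)].

(* [K] records which element of each maximal inseparable set is not excluded;
   it is a set rather than a choice function so that [E] may be empty. *)
Definition essential_ground (E : finType) (L : {set {set E}}) (E' : {set E})
  : Prop :=
  exists2 K : {set E},
    forall Z, maxset (inseparable L) Z -> #|Z :&: K| = 1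
  & E' = [set e | separated L e &&
                  [forall Z, maxset (inseparable L) Z && (e \in Z)
                               ==> (e \in K)]].

Definition essential_family (E : finType) (L : {set {set E}}) (E' : {set E})
  : {set {set E}} := [set X :&: E' | X in L].

(* A bijection between the ground sets of two essentializations is a map of
   subtypes, since [E2] may be empty while [E1] is not. *)
Definition subset_image (E1 E2 : finType) (A1 : {set E1}) (A2 : {set E2})
    (phi : {e : E1 | e \in A1} -> {e : E2 | e \in A2}) (X : {set E1})
  : {set E2} := [set val (phi e) | e in [pred e | val e \in X]].

Record family_iso (E1 E2 : finType) (L1 : {set {set E1}})
    (L2 : {set {set E2}}) := FamilyIso {
  ground1 : {set E1};
  ground2 : {set E2};
  ground1_essential : essential_ground L1 ground1;
  ground2_essential : essential_ground L2 ground2;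
  ground_map : {e : E1 | e \in ground1} -> {e : E2 | e \in ground2};
  ground_map_bij : bijective ground_map;
  ground_map_family :
    [set subset_image ground_map X | X in essential_family L1 ground1]
      = essential_family L2 ground2
}.

Definition identified (E1 E2 : finType) (L1 : {set {set E1}})
    (L2 : {set {set E2}}) (f : family_iso L1 L2)
    (X : {X : {set E1} | X \in L1}) (Y : {Y : {set E2} | Y \in L2}) : Prop :=
  subset_image (@ground_map _ _ _ _ f) (val X :&: ground1 f) = val Y :&: ground2 f.

(* Main.v *)
(** By injectivity only the closed set [E] has empty cover set, since its image
    is [tau set0].  So if [M] is maximal among the closed sets avoiding [e],
    then [cov M = [set e]] and [cover_closure M = tau [set e]]; by injectivity
    again, there is only one such [M], and it contains every closed set avoiding
    [e].  It follows that [tau A] is the union of [tau set0] and of the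
    [tau [set a]] for [a] in [A], so that the closed sets are the order ideals
    of [~: tau set0] for the order [x <= y] iff [x \in tau [set y]]. *)
From HB Require Import structures.
Require Import Defs.
From mathcomp Require Import all_boot all_order.

Set Implicit Arguments.
Unset Strict Implicit.
Unset Printing Implicit Defensive.

(** * Essentialization when only non-separated elements are inseparable *)

(** As [setT] is in [L], a non-separated element lies in every member of [L]. The set [N] of these
    elements is therefore the only possible maximal inseparable set, and dropping the non-separated
    elements already removes it entirely. *)
Lemma essential_ground_separated (E : finType) (L : {set {set E}}) :
  setT \in L ->
  (forall Z e, inseparable L Z -> e \in Z -> ~~ separated L e) ->
  essential_ground L [set e | separated L e].
Proof.
move=> LT insepN; pose N := [set e | ~~ separated L e].
have NW e W : e \in N -> W \in L -> e \in W.
  rewrite inE negb_and => /orP[] /exists_inPn h WL.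
    by have := h _ LT; rewrite inE.
  by have := h _ WL; rewrite negbK.
have maxN Z : maxset (inseparable L) Z -> Z = N.
  move=> /maxsetP[insZ maxZ]; have ZN : Z \subset N.
    by apply/subsetP => e eZ; rewrite inE (insepN Z).
  apply/esym/maxZ => //; apply/andP; split.
    by case/andP: insZ => /leq_trans-> //; apply: subset_leq_card.
  apply/forall_inP => e eN; apply/forall_inP => W WL; apply/implyP => _.
  by apply/subsetP => f fN; apply: NW.
have groundE (K : {set E}) : [set e | separated L e] =
    [set e | separated L e &&
             [forall Z, maxset (inseparable L) Z && (e \in Z) ==> (e \in K)]].
  apply/setP => e; rewrite !inE; case: (boolP (separated L e)) => // sepe.
  apply/esym/forallP => Z; apply/implyP => /andP[/maxsetp insZ eZ].
  by have := insepN Z e insZ eZ; rewrite sepe.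
(* [K] has no effect on the ground set; it only has to meet [N] once if [N] is a maximal inseparable
   set, which an empty [N] cannot be. *)
have [N0|[e0 e0N]] := set_0Vmem N.
  exists set0 => // Z maxZ.
  by have /andP[] := maxsetp maxZ; rewrite (maxN Z maxZ) N0 cards0.
exists [set e0] => // Z /maxN->.
by apply/eqP/cards1P; exists e0; apply/setIidPr; rewrite sub1set.
Qed.

Lemma order_idealP (d : Order.disp_t) (P : finPOrderType d) (I : {set P}) :
  reflect (forall x y, y \in I -> (x <= y)%O -> x \in I) (I \in order_ideals P).
Proof.
rewrite inE; apply: (iffP forall_inP) => [h x y yI xy|h y yI].
  by have /forallP/(_ x)/implyP := h y yI; apply.
by apply/forallP => x; apply/implyP; apply: h yI.
Qed.

(** Two elements of an inseparable set lie in each other's principal ideals, so they are equal by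
    antisymmetry. *)
Lemma essential_ground_ideals (d : Order.disp_t) (P : finPOrderType d) :
  essential_ground (order_ideals P) setT.
Proof.
have sep (p : P) : separated (order_ideals P) p.
  apply/andP; split; apply/exists_inP.
    by exists setT; [apply/order_idealP => x y; rewrite !inE | rewrite inE].
  by exists set0; [apply/order_idealP => x y; rewrite inE | rewrite inE].
have -> : [set: P] = [set e | separated (order_ideals P) e].
  by apply/setP => p; rewrite !inE sep.
apply: essential_ground_separated.
  by apply/order_idealP => x y; rewrite !inE.
move=> Z e /andP[Z1 /forall_inP insZ] eZ; apply: contraL Z1 => _.
rewrite -leqNgt -(cards1 e); apply/subset_leq_card/subsetP.
have below a b : a \in Z -> b \in Z -> (b <= a)%O.
  pose W := [set p : P | (p <= a)%O].
  move=> aZ bZ; have WL : W \in order_ideals P.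
    apply/order_idealP => x y; rewrite !inE => ya xy.
    exact: Order.POrderTheory.le_trans ya.
  have /forall_inP/(_ W WL) := insZ a aZ.
  by rewrite inE Order.POrderTheory.lexx => /subsetP/(_ b bZ); rewrite inE.
move=> f fZ; rewrite inE; apply/eqP/Order.POrderTheory.le_anti.
by rewrite !below.
Qed.

(** * Closure operators with injective cover-closure *)

Section ClosureOperator.

Variables (E : finType) (tau : closure_operator E).
Implicit Types (X Y A M : {set E}) (e f x y : E).
Let L := closed_sets tau.

Lemma mem_clo1 e : e \in tau [set e].
Proof. by rewrite -sub1set clo_ext. Qed.

Lemma clo_sub A X : X \in L -> A \subset X -> tau A \subset X.
Proof. by rewrite inE => /eqP {2}<-; apply: clo_mono. Qed.

Lemma clo1_sub e X : X \in L -> e \in X -> tau [set e] \subset X.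
Proof. by move=> XL eX; rewrite clo_sub ?sub1set. Qed.

Lemma clo0_sub X : X \in L -> tau set0 \subset X.
Proof. by move=> XL; rewrite clo_sub ?sub0set. Qed.

Lemma closedT : setT \in L.
Proof. by rewrite inE eqEsubset subsetT clo_ext. Qed.

Lemma separated_closed e : separated L e = (e \notin tau set0).
Proof.
apply/andP/idP => [[_ /exists_inP[Y YL]]|e0].
  by apply: contra => /(subsetP (clo0_sub YL)).
split; apply/exists_inP.
  by exists setT; [exact: closedT | rewrite inE].
by exists (tau set0); rewrite ?clo_closed.
Qed.

Hypothesis xi_inj : injective (cover_closure (tau := tau)).

Lemma clo_cov_inj X Y :
  X \in L -> Y \in L -> tau (cov L X) = tau (cov L Y) -> X = Y.
Proof.
move=> XL YL eXY.
have /xi_inj [] // : cover_closure (exist _ X XL) = cover_closure (exist _ Y YL).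
exact/val_inj.
Qed.

Lemma cov_nonempty X : X \in L -> X != setT -> exists e, e \in cov L X.
Proof.
move=> XL XT; have [covX|[e]] := set_0Vmem (cov L X); last by exists e.
case/eqP: XT; apply: clo_cov_inj; rewrite ?closedT // covX.
by congr (tau _); apply/setP => e; rewrite !inE.
Qed.

Lemma copoint_exists e X : X \in L -> e \notin X ->
  exists M, [/\ M \in L, X \subset M, e \notin M & cov L M = [set e]].
Proof.
move=> XL eX; pose avoids Y := (Y \in L) && (e \notin Y).
have [|M /maxsetP[/andP[ML eM] maxM] XM] := @maxset_exists _ avoids X.
  exact/andP.
exists M; split=> //.
(* Adding to [M] a cover element other than [e] would give a larger closed set still avoiding
   [e]. *)
have cove f : f \in cov L M -> f = e.
  rewrite inE => /andP[fM MfL]; apply/eqP; rewrite eq_sym.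
  apply: contraR fM => ef; rewrite -(maxM (M :|: [set f])) ?subsetUl //.
    by rewrite inE set11 orbT.
  by rewrite /avoids MfL !inE negb_or eM.
have [|f fcov] := cov_nonempty ML.
  by apply: contraNneq eM => ->; rewrite inE.
apply/eqP; rewrite eqEsubset sub1set; apply/andP; split.
  by apply/subsetP => g /cove->; rewrite inE.
by rewrite -(cove f fcov).
Qed.

(** Outside [tau set0], closure is determined by the closures of singletons. By contraposition, if
    no [tau [set a]] contains [x], a single closed set avoiding [x] contains all of [A]. *)
Lemma mem_clo A x : x \in tau A -> x \notin tau set0 ->
  exists2 a, a \in A & x \in tau [set a].
Proof.
move=> xA x0; apply/exists_inP; apply: contraLR xA => /exists_inPn xA.
have [M [ML _ xM covM]] := copoint_exists (clo_closed tau _) x0.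
apply: contra xM; apply/subsetP/clo_sub => //; apply/subsetP => a aA.
(* [M'] is chosen above [tau [set a]] and [M] independently of [a]; both have cover set [[set x]],
   so they coincide. *)
have [M' [M'L aM' _ covM']] := copoint_exists (clo_closed tau _) (xA a aA).
have -> : M = M' by apply: clo_cov_inj => //; rewrite covM covM'.
exact: subsetP aM' _ (mem_clo1 a).
Qed.

(** Take a closed [M] avoiding [e] with [M :|: [set e]] closed. The latter contains [f], whereas [M]
    does not, since [f] would bring [e] with it; so [f] is the added element. *)
Lemma clo1_anti e f : e \notin tau set0 ->
  e \in tau [set f] -> f \in tau [set e] -> e = f.
Proof.
move=> e0 ef fe.
have [M [ML _ eM covM]] := copoint_exists (clo_closed tau _) e0.
have : e \in cov L M by rewrite covM set11.
rewrite inE eM /= => MeL.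
have : f \in M :|: [set e].
  by apply: subsetP (clo1_sub MeL _) _ fe; rewrite !inE eqxx orbT.
rewrite !inE => /orP[fM|/eqP//].
by case/negP: eM; apply: subsetP (clo1_sub ML fM) _ ef.
Qed.

Lemma closedP X :
  reflect (tau set0 \subset X /\ forall x y, y \in X -> x \in tau [set y] -> x \in X)
          (X \in L).
Proof.
apply: (iffP idP) => [XL|[X0 Xdown]].
  split=> [|x y yX]; [exact: clo0_sub | exact/subsetP/clo1_sub].
rewrite inE eqEsubset clo_ext andbT; apply/subsetP => x xX.
have [x0|x0] := boolP (x \in tau set0); first exact: subsetP X0 _ x0.
by have [y yX] := mem_clo xX x0; apply: Xdown.
Qed.

Lemma essential_ground_closed : essential_ground L (~: tau set0).
Proof.
have -> : ~: tau set0 = [set e | separated L e].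
  by apply/setP => e; rewrite !inE separated_closed.
apply: essential_ground_separated; first exact: closedT.
move=> Z e /andP[Z1 /forall_inP insZ] eZ; apply: contraL Z1 => sepe.
rewrite separated_closed in sepe; rewrite -leqNgt -(cards1 e).
apply/subset_leq_card/subsetP => f fZ; rewrite inE eq_sym.
have below a b : a \in Z -> b \in Z -> b \in tau [set a].
  move=> aZ; have /forall_inP/(_ _ (clo_closed tau [set a])) := insZ a aZ.
  by rewrite mem_clo1 => /subsetP; apply.
by apply/eqP/clo1_anti; rewrite ?below.
Qed.

(** * The poset and its order ideals *)

Local Notation nonloop := {e : E | e \in ~: tau set0}.

(** The specialization order of [tau]. The elements of [tau set0] (loops, in matroid terms) are left
    out, since any two of them lie in each other's closure. *)
Definition nonloop_le (x y : nonloop) := val x \in tau [set val y].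

Lemma nonloop_le_refl : reflexive nonloop_le.
Proof. by move=> x; apply: mem_clo1. Qed.

Lemma nonloop_le_anti : antisymmetric nonloop_le.
Proof.
move=> x y /andP[xy yx]; apply/val_inj/clo1_anti => //.
by have := valP x; rewrite inE.
Qed.

Lemma nonloop_le_trans : transitive nonloop_le.
Proof.
by move=> y x z xy yz; apply: subsetP (clo1_sub (clo_closed _ _) yz) _ xy.
Qed.

Definition nonloop_poset : finPOrderType (Order.Disp tt tt) :=
  HB.pack nonloop (Order.Le_isPOrder.Build (Order.Disp tt tt) nonloop
    nonloop_le_refl nonloop_le_anti nonloop_le_trans).

Lemma nonloop_poset_leE (x y : nonloop_poset) :
  (x <= y)%O = (sval x \in tau [set sval y]).
Proof. by []. Qed.

Local Notation P := nonloop_poset.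

Definition trace X : {set P} := [set p | sval p \in X].

Lemma trace_ideal X : X \in L -> trace X \in order_ideals P.
Proof.
move=> XL; apply/order_idealP => x y; rewrite !inE nonloop_poset_leE => yX.
exact/subsetP/clo1_sub.
Qed.

Lemma ideal_trace (I : {set P}) :
  I \in order_ideals P -> exists2 X, X \in L & trace X = I.
Proof.
(* Every closed set contains the loops, so they have to be put back. *)
move=> /order_idealP Idown; pose X := tau set0 :|: [set sval p | p in I].
have trX : trace X = I.
  apply/setP => p; have p0 := valP p; rewrite inE in p0.
  rewrite !inE (negbTE p0) /=; exact: (mem_imset I p val_inj).
exists X => //; apply/closedP; split=> [|x y]; first exact: subsetUl.
rewrite inE => /orP[y0 xy|/imsetP[q qI ->] xq].
  by rewrite inE (subsetP (clo1_sub (clo_closed _ _) y0)).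
rewrite inE -implyNb; apply/implyP => x0.
have xC : x \in ~: tau set0 by rewrite inE.
apply/imsetP; exists (exist _ x xC : P) => //.
exact: Idown qI _.
Qed.

(** * Cover-closure as rowmotion *)

(** By [closedP], adding [y] to [X] keeps it closed exactly when everything below [y] is in [X] or
    is [y] itself, which is minimality of [y] outside [X]. *)
Lemma minimal_trace X (y : P) : X \in L ->
  (y \in minimal_elements (~: trace X)) = (sval y \in cov L X).
Proof.
move=> XL; rewrite inE [in RHS]inE 2!inE -/L.
case: (boolP (sval y \in X)) => //= yX.
apply/forall_inP/idP => [miny|XyL z].
  have [X0 Xdown] := elimT (closedP X) XL.
  apply/closedP; split=> [|b a]; first by rewrite (subset_trans X0) ?subsetUl.
  rewrite !inE => /orP[aX /(Xdown _ _ aX)->//|/eqP-> b_le].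
  (* An element [b] outside [X] is a nonloop, so the minimality of [y] applies to it and forces [b]
     to be [y]. *)
  apply/orP; have [|bX] := boolP (b \in X); [by left | right].
  have bC : b \in ~: tau set0 by rewrite inE; apply: contra bX; apply/subsetP.
  have := miny (exist _ b bC : P); rewrite !inE => /(_ bX).
  rewrite Order.POrderTheory.lt_neqAle nonloop_poset_leE b_le andbT negbK.
  by move=> /eqP<-.
rewrite !inE => zX; apply/negP; rewrite Order.POrderTheory.lt_neqAle.
rewrite nonloop_poset_leE => /andP[zy z_le].
have : sval z \in X :|: [set sval y].
  by apply: subsetP (clo1_sub XyL _) _ z_le; rewrite !inE eqxx orbT.
rewrite !inE (negbTE zX) /= => /eqP/val_inj zyE.
by rewrite zyE eqxx in zy.
Qed.

(** By [mem_clo], a nonloop in the closure of the cover set lies below one of the cover elements,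
    which are the minimal elements of the complement. *)
Lemma trace_clo_cov X : X \in L ->
  trace (tau (cov L X)) = generated_ideal (minimal_elements (~: trace X)).
Proof.
move=> XL; apply/setP => p; rewrite !inE; apply/idP/exists_inP => [pX|].
  have [|a acov pa] := mem_clo pX; first by have := valP p; rewrite inE.
  have aC : a \in ~: tau set0.
    move: acov; rewrite !inE => /andP[aX _].
    by apply: contra aX; apply/subsetP/clo0_sub.
  by exists (exist _ a aC : P); rewrite ?minimal_trace.
move=> [y]; rewrite minimal_trace // => ycov; rewrite nonloop_poset_leE.
by apply/subsetP/clo_mono; rewrite sub1set.
Qed.

(** The nonloops are already the carrier of [P], so the ground map only adds the trivial membership
    proof that [family_iso] asks for. *)
Definition nonloop_embed (x : nonloop) :
  {p : P | p \in [set: P]} := exist _ x (in_setT _).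

Lemma nonloop_embed_bij : bijective nonloop_embed.
Proof. by exists (fun p => val p) => // p; apply: val_inj. Qed.

Lemma subset_image_embed X :
  subset_image nonloop_embed (X :&: ~: tau set0) = trace X.
Proof.
apply/setP => p; rewrite [RHS]inE; apply/imsetP/idP => [[x]|pX].
  by rewrite !inE => /andP[xX _] ->.
exists p => //; have := valP p; rewrite !inE => ->; rewrite andbT.
exact: pX.
Qed.

Lemma nonloop_embed_family :
  [set subset_image nonloop_embed X | X in essential_family L (~: tau set0)]
    = essential_family (order_ideals P) setT.
Proof.
rewrite /essential_family -imset_comp; apply/setP => I.
apply/imsetP/imsetP => [[X XL ->]|[J JI ->]].
  by exists (trace X); rewrite ?trace_ideal //= subset_image_embed setIT.
have [X XL <-] := ideal_trace JI.
by exists X; rewrite //= subset_image_embed setIT.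
Qed.

Definition nonloop_iso : family_iso L (order_ideals P) :=
  FamilyIso essential_ground_closed (essential_ground_ideals P)
    nonloop_embed_bij nonloop_embed_family.

Lemma identified_nonloop_iso (X : {X : {set E} | X \in L})
    (I : {I : {set P} | I \in order_ideals P}) :
  identified nonloop_iso X I <-> trace (val X) = val I.
Proof. by rewrite /identified /= setIT subset_image_embed. Qed.

End ClosureOperator.

Theorem corollary4p9 (E : finType) (tau : closure_operator E)
  (xi_bij : bijective (cover_closure (tau := tau))) :
  exists (d : Order.disp_t) (P : finPOrderType d)
         (f : family_iso (closed_sets tau) (order_ideals P)),
    forall (X : {X : {set E} | X \in closed_sets tau})
           (I : {I : {set P} | I \in order_ideals P}),
      identified f X I -> identified f (cover_closure X) (rowmotion I).
Proof.
have xi_inj := bij_inj xi_bij.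
exists _, (nonloop_poset xi_inj), (nonloop_iso xi_inj) => X I.
move=> /identified_nonloop_iso XI; apply/identified_nonloop_iso.
by rewrite /= -XI trace_clo_cov //; apply: valP.
Qed.
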